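(* For every integer $m \geqslant 1$, the function $\tau_m : \mathbb{Z}_2^{2m} \to \mathbb{Z}_2$ (the non-diagonal-symmetry function defined in the context) is a bent function on $\mathbb{Z}_2^{2m}$.
   Context: Bent functions. The Sylvester Hadamard matrix $H_n$ of order $2^n$ is defined by $H_1 := \begin{pmatrix} 1 & 1 \\ 1 & -1 \end{pmatrix}$ and $H_n := H_{n-1} \otimes H_1$ for $n > 1$. For a Boolean function $f : \mathbb{Z}_2^n \to \mathbb{Z}_2$, let $\underline{f} := [(-1)^{f[0]}, (-1)^{f[1]}, \ldots, (-1)^{f[2^n-1]}]^T$, where $f[i]$ is the value of $f$ on the $n$ binary digits of $i$. The function $f$ is bent if every entry of $H_n \underline{f}$ has the same absolute value, i.e. $|H_n \underline{f}| = C[1,\ldots,1]^T$ (entrywise absolute value) for some constant $C$. Basis matrices. Let $\mathrm{E}_1 := \begin{pmatrix} 0 & -1 \\ 1 & 0 \end{pmatrix}$ and $\mathrm{E}_2 := \begin{pmatrix} 0 & 1 \\ 1 & 0 \end{pmatrix}$. Define $\gamma_1$ on $\mathbb{Z}_2^2$ (bit pairs) by $\gamma_1(00) = I$, $\gamma_1(01) = \mathrm{E}_1$, $\gamma_1(10) = \mathrm{E}_2$, $\gamma_1(11) = \mathrm{E}_1\mathrm{E}_2$. For $m > 1$, define $\gamma_m$ on $\mathbb{Z}_2^{2m}$ by $\gamma_m(p \odot i) := \gamma_1(p) \otimes \gamma_{m-1}(i)$ for $p \in \mathbb{Z}_2^2$, $i \in \mathbb{Z}_2^{2m-2}$, where $\odot$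 denotes concatenation of bit vectors and $\otimes$ the Kronecker product. (The $2^m \times 2^m$ matrices $\gamma_m(i)$, $i \in \mathbb{Z}_2^{2m}$, form a basis of the real representation of the Clifford algebra $\mathbb{R}_{m,m}$; each squares to $I$ or $-I$.) Sign-of-square function. $\sigma_m : \mathbb{Z}_2^{2m} \to \mathbb{Z}_2$ is defined by $\sigma_m(i) = 1$ if $\gamma_m(i)^2 = -I$, and $\sigma_m(i) = 0$ if $\gamma_m(i)^2 = I$. Non-diagonal-symmetry function. $\tau_m : \mathbb{Z}_2^{2m} \to \mathbb{Z}_2$ is defined recursively: $\tau_1(10) = 1$ and $\tau_1(00)=\tau_1(01)=\tau_1(11) = 0$; for $m > 1$ and $i \in \mathbb{Z}_2^{2m-2}$, $\tau_m(00 \odot i) := \tau_{m-1}(i)$, $\tau_m(01 \odot i) := \sigma_{m-1}(i)$, $\tau_m(10 \odot i) := \sigma_{m-1}(i) + 1$, $\tau_m(11 \odot i) := \tau_{m-1}(i)$, with addition in $\mathbb{Z}_2$. *)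

(* Defs.v *)
From mathcomp Require Import all_boot all_order all_algebra.
From mathcomp Require Import mxtens.

Set Implicit Arguments.
Unset Strict Implicit.
Unset Printing Implicit Defensive.

Import Order.TTheory GRing.Theory Num.Theory.
Local Open Scope ring_scope.

Notation Z2 := 'F_2.

(* Z_2^n is [n.-tuple Z2]; the digits of an index are listed from the most
   significant to the least significant, so that concatenation p (.) i puts p
   in the high-order positions. *)
Definition digits (n j : nat) : n.-tuple Z2 :=
  [tuple ((j %/ 2 ^ (n - k.+1)) %% 2)%N%:R | k < n].

Definition pair_head (n : nat) (i : n.+2.-tuple Z2) : 2.-tuple Z2 :=
  [tuple thead i; thead [tuple of behead i]].

Definition pair_tail (n : nat) (i : n.+2.-tuple Z2) : n.-tuple Z2 :=
  [tuple of behead (behead i)].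

Section Matrices.
Variable R : realFieldType.

Definition mx2 (a b c d : R) : 'M[R]_2 :=
  \matrix_(i < 2, j < 2)
    if i == ord0 then (if j == ord0 then a else b)
    else (if j == ord0 then c else d).

Definition H1 : 'M[R]_2 := mx2 1 1 1 (-1).

(* [sylvester_rec k] is H_(k + 1); the cast identifies 2 ^ k.+1 * 2 with
   2 ^ k.+2. *)
Fixpoint sylvester_rec (k : nat) : 'M[R]_(2 ^ k.+1) :=
  if k is k'.+1 return 'M[R]_(2 ^ k.+1) then
    castmx (esym (expnSr 2 k'.+1), esym (expnSr 2 k'.+1)) (sylvester_rec k' *t H1)
  else H1.

(* The value at 0 is a convention, as for [gamma] and [tau] below. *)
Definition sylvester (n : nat) : 'M[R]_(2 ^ n) :=
  if n is k.+1 then sylvester_rec k else 1%:M.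

Definition sign_vector (n : nat) (f : n.-tuple Z2 -> Z2) : 'cV[R]_(2 ^ n) :=
  \col_j (-1) ^+ f (digits n j).

Definition bent (n : nat) (f : n.-tuple Z2 -> Z2) : Prop :=
  exists C : R,
    map_mx Num.norm (sylvester n *m sign_vector f) = C *: const_mx 1.

Definition E1 : 'M[R]_2 := mx2 0 (-1) 1 0.
Definition E2 : 'M[R]_2 := mx2 0 1 1 0.

Definition gamma1 (p : 2.-tuple Z2) : 'M[R]_2 :=
  if p == [tuple 0; 0] then 1%:M
  else if p == [tuple 0; 1] then E1
  else if p == [tuple 1; 0] then E2
  else E1 *m E2.

Fixpoint gamma_rec (k : nat) : k.+1.*2.-tuple Z2 -> 'M[R]_(2 ^ k.+1) :=
  if k is k'.+1 return k.+1.*2.-tuple Z2 -> 'M[R]_(2 ^ k.+1) then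
    fun i => gamma1 (pair_head i) *t gamma_rec (pair_tail i)
  else gamma1.

Definition gamma (m : nat) : m.*2.-tuple Z2 -> 'M[R]_(2 ^ m) :=
  if m is k.+1 then @gamma_rec k else fun=> 1%:M.

(* [gamma_sqr] below shows that the square is 1 in the second case. *)
Definition sigma (m : nat) (i : m.*2.-tuple Z2) : Z2 :=
  if gamma i *m gamma i == - 1%:M then 1 else 0.

Definition tau1 (p : 2.-tuple Z2) : Z2 :=
  if p == [tuple 1; 0] then 1 else 0.

Fixpoint tau_rec (k : nat) : k.+1.*2.-tuple Z2 -> Z2 :=
  if k is k'.+1 return k.+1.*2.-tuple Z2 -> Z2 then
    fun i =>
      let p := pair_head i in
      let j := pair_tail i in
      if p == [tuple 0; 0] then tau_rec j
      else if p == [tuple 0; 1] then @sigma k'.+1 j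
      else if p == [tuple 1; 0] then @sigma k'.+1 j + 1
      else tau_rec j
  else tau1.

Definition tau (m : nat) : m.*2.-tuple Z2 -> Z2 :=
  if m is k.+1 then @tau_rec k else fun=> 0.

Lemma pair_head_cat (n : nat) (p : 2.-tuple Z2) (i : n.-tuple Z2) :
  pair_head [tuple of p ++ i] = p.
Proof.
case/tupleP: p => a p; case/tupleP: p => b p; rewrite (tuple0 p); apply: val_inj.
by rewrite /= /thead !(tnth_nth 0).
Qed.

Lemma pair_tail_cat (n : nat) (p : 2.-tuple Z2) (i : n.-tuple Z2) :
  pair_tail [tuple of p ++ i] = i.
Proof.
by case/tupleP: p => a p; case/tupleP: p => b p; rewrite (tuple0 p); apply: val_inj.
Qed.

Lemma gamma_cat (m : nat) (p : 2.-tuple Z2) (i : m.+1.*2.-tuple Z2) :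
  @gamma m.+2 [tuple of p ++ i] = gamma1 p *t gamma i.
Proof.
by rewrite -[in gamma1 p](pair_head_cat p i) -[in gamma i](pair_tail_cat p i).
Qed.

Lemma tau_cat (m : nat) (i : m.+1.*2.-tuple Z2) :
  [/\ @tau m.+2 [tuple of [tuple 0; 0] ++ i] = tau i,
      @tau m.+2 [tuple of [tuple 0; 1] ++ i] = sigma i,
      @tau m.+2 [tuple of [tuple 1; 0] ++ i] = sigma i + 1 &
      @tau m.+2 [tuple of [tuple 1; 1] ++ i] = tau i].
Proof.
have tE (p : 2.-tuple Z2) : @tau m.+2 [tuple of p ++ i] =
    if p == [tuple 0; 0] then tau i
    else if p == [tuple 0; 1] then sigma i
    else if p == [tuple 1; 0] then sigma i + 1 else tau i.
  by rewrite /tau /= pair_head_cat pair_tail_cat.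
by split; rewrite tE.
Qed.

Lemma gamma1_sqr (p : 2.-tuple Z2) :
  exists b : bool, gamma1 p *m gamma1 p = (-1) ^+ b *: 1%:M.
Proof.
have sqr (b : bool) (A : 'M[R]_2) :
    (forall i j, (A *m A) i j = ((-1) ^+ b *: 1%:M : 'M_2) i j) ->
    exists b : bool, A *m A = (-1) ^+ b *: 1%:M.
  by move=> AE; exists b; apply/matrixP.
rewrite /gamma1; case: ifP => _; first by exists false; rewrite mulmx1 scale1r.
case: ifP => _; [|case: ifP => _].
- apply: (sqr true) => -[[|[]] //= ?] -[[|[]] //= ?];
  by rewrite !mxE !big_ord_recl big_ord0 !mxE /= ?(mulr0, mul0r, mulr1, mul1r, addr0, add0r).
- apply: (sqr false) => -[[|[]] //= ?] -[[|[]] //= ?];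
  by rewrite !mxE !big_ord_recl big_ord0 !mxE /= ?(mulr0, mul0r, mulr1, mul1r, addr0, add0r).
- apply: (sqr false) => -[[|[]] //= ?] -[[|[]] //= ?];
  by rewrite !mxE !big_ord_recl big_ord0 !mxE !big_ord_recl !big_ord0 !mxE /=
     ?(mulr0, mul0r, mulr1, mul1r, addr0, add0r, mulrNN).
Qed.

Lemma tens_1mx (m n : nat) : (1%:M : 'M[R]_m) *t (1%:M : 'M[R]_n) = 1%:M.
Proof.
apply/matrixP => i j; case: (mxtens_indexP i) => a b.
case: (mxtens_indexP j) => c d; rewrite tensmxE !mxE.
by rewrite (can_eq (@mxtens_indexK m n)) xpair_eqE -natrM mulnb.
Qed.

Lemma gamma_sqr (m : nat) (i : m.*2.-tuple Z2) :
  gamma i *m gamma i = 1%:M \/ gamma i *m gamma i = - 1%:M.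
Proof.
suff [b ->] : exists b : bool, gamma i *m gamma i = (-1) ^+ b *: 1%:M.
  by case: b; [right; rewrite scaleN1r | left; rewrite scale1r].
elim: m i => [|[|m] IH] i; first by exists false; rewrite mulmx1 scale1r.
  exact: gamma1_sqr.
have [b Eb] := IH (pair_tail i); have [c Ec] := gamma1_sqr (pair_head i).
exists (c (+) b); rewrite [gamma i]/(_ *t _) tensmx_mul Ec Eb.
apply/matrixP => k l; rewrite -tens_1mx !mxE.
by rewrite signr_addb -!mulrA; congr (_ * _); rewrite mulrCA.
Qed.

End Matrices.

(* Main.v *)
(** Let S_m and T_m be the Walsh-Hadamard transforms of (-1)^sigma_m and
(-1)^tau_m. Splitting off the two leading digits of the argument gives
  S_(m+1)(u v w) = +-2 S_m(w),
since the signs of the squares multiply under Kronecker products and sigma_1 is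
bent, and
  T_(m+1)(u v w) = (1 + (-1)^(u+v)) T_m(w) + ((-1)^v - (-1)^u) S_m(w),
where exactly one of the two coefficients vanishes and the other is +-2. By
induction |S_m| = |T_m| = 2^m everywhere. With sigma_0 = tau_0 = 0 both
recursions hold from m = 0 on. *)
Require Import Defs.
From mathcomp Require Import all_boot all_order all_algebra.
From mathcomp Require Import mxtens ring zify.

Set Implicit Arguments.
Unset Strict Implicit.
Unset Printing Implicit Defensive.

Import Order.TTheory GRing.Theory Num.Theory.
Local Open Scope ring_scope.

(** As [k < n], the term [q * 2 ^ n] is an even multiple of [2 ^ k], so bit [k] does not see the
    leading digits. *)
Lemma odd_divn_exp2D (k n q r : nat) : (k < n)%N ->
  odd ((q * 2 ^ n + r) %/ 2 ^ k) = odd (r %/ 2 ^ k).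
Proof.
move=> lt_kn; rewrite -(subnK (ltnW lt_kn)) expnD mulnA divnMDl ?expn_gt0 //.
by rewrite oddD oddM oddX subn_eq0 leqNgt lt_kn /= andbF.
Qed.

Lemma digits_high (n r : nat) (b : bool) : (r < 2 ^ n)%N ->
  digits n.+1 (b * 2 ^ n + r) = cons_tuple b%:R (digits n r).
Proof.
move=> lt_r; apply: eq_from_tnth => k; rewrite tnth_mktuple.
case: (unliftP ord0 k) => [k'|] ->; last first.
  by rewrite tnth0 /= subn1 /= divnMDl ?expn_gt0 // divn_small // addn0; case: b.
rewrite tnthS tnth_mktuple /= /bump /= add1n subSS !modn2.
by rewrite odd_divn_exp2D //; have := ltn_ord k'; lia.
Qed.

Section WalshHadamard.
Variable R : realFieldType.

(** The character (-1)^(i . j) of Z_2^n, with i . j the dot product of the [n] low binary digits. *)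
Definition walsh_char (n i j : nat) : R :=
  \prod_(k < n) (-1) ^+ (odd (i %/ 2 ^ k) && odd (j %/ 2 ^ k)).

(** The right Kronecker factor [H1] carries the lowest bit of each index, hence the factor [k = 0]
    of the product. *)
Lemma sylvesterE (n : nat) (i j : 'I_(2 ^ n)) :
  sylvester R n i j = walsh_char n i j.
Proof.
have H1E (a b : 'I_2) : H1 R a b = (-1) ^+ (odd a && odd b).
  by case: a b => -[|[]] // ? [[|[]] // ?]; rewrite !mxE.
case: n i j => [|n] i j.
  by rewrite /walsh_char big_ord0 !ord1 mxE eqxx.
rewrite /sylvester; elim: n i j => [|n IH] i j.
  by rewrite /walsh_char big_ord1 H1E !divn1.
rewrite castmxE /= mxE IH H1E /walsh_char [RHS]big_ord_recl mulrC /=.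
congr (_ * _); first by rewrite !modn2 !divn1 !oddb.
by apply: eq_bigr => k _; rewrite -!divnMA -!expnS.
Qed.

(* The index [i] may exceed [2 ^ n]: only its [n] low-order digits matter, so
   [i] need not be reduced when leading digits are split off. *)
Definition walsh (n : nat) (f : n.-tuple Z2 -> Z2) (i : nat) : R :=
  \sum_(0 <= j < 2 ^ n) walsh_char n i j * (-1) ^+ f (digits n j).

Lemma walsh0 (f : 0.-tuple Z2 -> Z2) (i : nat) :
  walsh f i = (-1) ^+ f [tuple].
Proof.
by rewrite /walsh big_nat1 /walsh_char big_ord0 mul1r (tuple0 (digits _ _)).
Qed.

(** The sum is cut at [2 ^ n], that is, by the leading digit of [j]. The Sylvester recursion splits
    off the lowest digit instead; the product form of [walsh_char] allows either. *)
Lemma walshS (n : nat) (f : n.+1.-tuple Z2 -> Z2) (i : nat) :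
  walsh f i = walsh (fun x => f (cons_tuple 0 x)) i
    + (-1) ^+ odd (i %/ 2 ^ n) * walsh (fun x => f (cons_tuple 1 x)) i.
Proof.
have charE (b : bool) (r : nat) : (r < 2 ^ n)%N ->
    walsh_char n.+1 i (b * 2 ^ n + r) =
      walsh_char n i r * (-1) ^+ (odd (i %/ 2 ^ n) && b).
  move=> lt_r; rewrite /walsh_char big_ord_recr /= divnMDl ?expn_gt0 //.
  rewrite (divn_small lt_r) addn0 oddb; congr (_ * _).
  by apply: eq_bigr => k _; rewrite odd_divn_exp2D.
rewrite /walsh (big_cat_nat (n := 2 ^ n)) ?leq_exp2l //=; congr (_ + _).
  apply: eq_big_nat => r /= lt_r.
  by rewrite -{1 2}[r]/(false * 2 ^ n + r)%N charE // andbF mulr1 digits_high.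
rewrite -{1}[(2 ^ n)%N]add0n big_addn expnS mul2n -addnn addnK big_distrr /=.
apply: eq_big_nat => r /= lt_r.
rewrite -[(r + 2 ^ n)%N]addnC -[X in (X + r)%N]mul1n.
by rewrite (charE true) // (digits_high true) // andbT mulrCA mulrA.
Qed.

Lemma walsh_scale (n : nat) (f g : n.-tuple Z2 -> Z2) (c : R) (i : nat) :
  (forall x, (-1) ^+ f x = c * (-1) ^+ g x) -> walsh f i = c * walsh g i.
Proof.
by move=> fg; rewrite big_distrr; apply: eq_bigr => j _; rewrite fg mulrCA.
Qed.

Lemma walsh_bent (n : nat) (f : n.-tuple Z2 -> Z2) (C : R) :
  (forall i, `|walsh f i| = C) -> bent R f.
Proof.
move=> fC; exists C; apply/matrixP => i j; rewrite !mxE mulr1 -(fC i) /walsh.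
by rewrite big_mkord; congr `|_|; apply: eq_bigr => k _; rewrite sylvesterE mxE.
Qed.

Lemma pair_head_cons (n : nat) (a b : Z2) (x : n.-tuple Z2) :
  pair_head (cons_tuple a (cons_tuple b x)) = [tuple a; b].
Proof. by apply: val_inj; rewrite /= /thead !(tnth_nth 0). Qed.

Lemma pair_tail_cons (n : nat) (a b : Z2) (x : n.-tuple Z2) :
  pair_tail (cons_tuple a (cons_tuple b x)) = x.
Proof. exact: val_inj. Qed.

Lemma sqr_sigma (m : nat) (x : m.*2.-tuple Z2) :
  gamma R x *m gamma R x = (-1) ^+ sigma R x *: 1%:M.
Proof.
rewrite /sigma; case: eqP => [->|]; first by rewrite scaleN1r.
by case: (gamma_sqr R x) => // ->; rewrite scale1r.
Qed.

(** The sign is read off a diagonal entry, which exists because [2 ^ m] is positive. *)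
Lemma sigma_sign (m : nat) (x : m.*2.-tuple Z2) (c : R) :
  gamma R x *m gamma R x = c *: 1%:M -> (-1) ^+ sigma R x = c.
Proof.
rewrite sqr_sigma => /matrixP eq_c; have lt0 : (0 < 2 ^ m)%N by rewrite expn_gt0.
by have := eq_c (Ordinal lt0) (Ordinal lt0); rewrite !mxE eqxx !mulr1.
Qed.

Lemma sigma0 (x : 0.*2.-tuple Z2) : @sigma R 0 x = 0.
Proof.
rewrite /sigma mulmx1; case: eqP => // /matrixP /(_ 0 0).
by rewrite !mxE eqxx => /eqP; rewrite -addr_eq0 (pnatr_eq0 R 2).
Qed.

Lemma sigma_cons (m : nat) (a b : Z2) (x : m.*2.-tuple Z2) :
  (-1) ^+ @sigma R m.+1 (cons_tuple a (cons_tuple b x)) =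
  (-1) ^+ @sigma R 1 [tuple a; b] * (-1) ^+ sigma R x :> R.
Proof.
case: m x => [|m] x.
  (* For [m = 0], [gamma] of order 1 is a base case and not a Kronecker product. *)
  by rewrite sigma0 mulr1; congr (_ ^+ @sigma _ 1 _); apply: val_inj; case: x => -[].
have gE : @gamma R m.+2 (cons_tuple a (cons_tuple b x)) =
    @gamma R 1 [tuple a; b] *t gamma R x.
  by rewrite /gamma /= pair_head_cons pair_tail_cons.
apply: sigma_sign; rewrite gE.
apply: etrans (tensmx_mul _ _ _ _) _.
rewrite (@sqr_sigma 1) (@sqr_sigma m.+1).
apply/matrixP => k l; rewrite -(tens_1mx R) !mxE.
by rewrite -!mulrA; congr (_ * _); rewrite mulrCA.
Qed.

(** Among the four basis matrices only [E1], at 01, squares to -I. *)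
Lemma sigma1E (b c : bool) :
  (-1) ^+ @sigma R 1 [tuple b%:R; c%:R] = (-1) ^+ (~~ b && c) :> R.
Proof.
apply: sigma_sign; apply/matrixP; rewrite /= /gamma1.
by case: b c => -[] /= -[[|[]] //= ?] [[|[]] //= ?];
  rewrite !mxE !big_ord_recl ?big_ord0 !mxE ?big_ord_recl ?big_ord0 ?mxE /=; ring.
Qed.

Lemma tau_cons (m : nat) (b c : bool) (x : m.*2.-tuple Z2) :
  (-1) ^+ @tau R m.+1 (cons_tuple b%:R (cons_tuple c%:R x)) =
  (if b == c then (-1) ^+ tau R x else (-1) ^+ b * (-1) ^+ sigma R x) :> R.
Proof.
case: m x => [|m] x.
  have -> : cons_tuple b%:R (cons_tuple c%:R x) = [tuple b%:R; c%:R].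
    by apply: val_inj; case: x => -[].
  by rewrite sigma0 mulr1; case: b c => -[].
rewrite /tau /= pair_head_cons pair_tail_cons.
case: b c => -[] /=; rewrite ?mul1r //.
(* Only the digits 10 remain. The sum [sigma + 1] is reduced in F_2 before it becomes an exponent,
   so both values of [sigma] are tried. *)
by rewrite /sigma; case: ifP => _; rewrite expr1 ?mulN1r ?opprK ?expr0 //.
Qed.

Lemma norm_walsh_sigma (m i : nat) : `|walsh (@sigma R m) i| = 2 ^+ m.
Proof.
elim: m => [|m IH].
  by rewrite walsh0 normrX normrN1 expr1n.
have sE (b c : bool) : walsh (fun x => @sigma R m.+1 (cons_tuple b%:R (cons_tuple c%:R x))) i =
    (-1) ^+ (~~ b && c) * walsh (@sigma R m) i.
  by apply: walsh_scale => x; rewrite sigma_cons sigma1E.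
rewrite !walshS (sE false false) (sE false true) (sE true false) (sE true true) exprS -IH.
rewrite -[2 in RHS](@ger0_norm R) // -normrM.
(* The four signed quarters add up to 2 or -2 times the smaller transform; the second alternative
   handles -2. *)
do 2!case: odd => /=;
  (by congr `|_|; ring) || (by rewrite -[RHS]normrN; congr `|_|; ring).
Qed.

Lemma norm_walsh_tau (m i : nat) : `|walsh (@tau R m) i| = 2 ^+ m.
Proof.
elim: m => [|m IH].
  by rewrite walsh0 normrX normrN1 expr1n.
have tE (b c : bool) :
    walsh (fun x => @tau R m.+1 (cons_tuple b%:R (cons_tuple c%:R x))) i =
    if b == c then walsh (@tau R m) i else (-1) ^+ b * walsh (@sigma R m) i.
  case: ifP => eq_bc; last by apply: walsh_scale => x; rewrite tau_cons eq_bc.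
  rewrite -[RHS]mul1r; apply: walsh_scale => x.
  by rewrite tau_cons eq_bc mul1r.
rewrite !walshS (tE false false) (tE false true) (tE true false) (tE true true).
(* In the first and last cases the two leading digits of [i] agree and only the [tau] transform
   survives; in the middle ones only the [sigma] transform does. [2 ^+ m] becomes the norm of the
   survivor. *)
rewrite exprS; case: odd; case: odd => /=;
  [rewrite -IH | rewrite -(norm_walsh_sigma m i) |
   rewrite -(norm_walsh_sigma m i) | rewrite -IH];
  rewrite -[2 in RHS](@ger0_norm R) // -normrM;
  (by congr `|_|; ring) || (by rewrite -[RHS]normrN; congr `|_|; ring).
Qed.

End WalshHadamard.

Theorem theorem3p1 (R : realFieldType) (m : nat) (hm : (1 <= m)%N) :
  bent R (@tau R m).
Proof. exact: walsh_bent (norm_walsh_tau R m). Qed.
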